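(* Let $\Omega\Subset\mathbb{C}^n$ be a domain, let $\nu$ be a finite Borel measure on $b\Omega$ with support $T$, and let $V$ be an irreducible, minimally defined germ of an analytic hypersurface in $\overline\Omega$ with $\Omega\cap V\ne\emptyset$ and $\nu(T\cap V)=0$. Put $\Omega_T=\Omega\cup T$ and $\Omega^*=\Omega\setminus V$. Assume that $\mathcal{A}(\Omega,\nu)$ is weakly admissible, and let $s$ be the Szegő kernel for $\mathfrak{H}^2(\Omega,\nu)$. Let $\varphi\in\mathcal{A}(\Omega,\nu)$ be such that $\varphi=h\psi$, where $\psi$ is a minimal defining function of $V$ and $h\in\mathcal{A}(\Omega,\nu)$ is nonvanishing on $\Omega_T\setminus V$. Then, for every $k\in\mathbb{N}_0$, the kernel $$c_{k,\varphi}(z,w):=\frac{\varphi^k(w)}{\varphi^k(z)}\,s(z,w),\qquad z\in\Omega^*,\ w\in T,$$ has the reproducing property for $\mathfrak{H}^2_k(\Omega^*,\nu)$. Moreover, if $h$ is nowhere vanishing on $\Omega_T$ and $|\varphi|$ is constant on $T$, then $c_{k,\varphi}$ is the Szegő kernel for $\mathfrak{H}^2_k(\Omega^*,\nu)$ for all $k\in\mathbb{N}_0$.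
   Context: Admissibility. Let $D\Subset\mathbb{C}^n$ be a domain, $\nu$ a finite Borel measure on the topological boundary $bD$, $T=\operatorname{supp}\nu$. A family $\mathcal{F}$ of complex-valued functions on $D\cup T$ is weakly admissible if (i) $F|_T\in L^2(\nu)$ for all $F\in\mathcal{F}$, and (ii) for every compact $K\subset D$ there is $C_K>0$ with $\sup_{z\in K}|F(z)|\le C_K\|F|_T\|_{L^2(\nu)}$ for all $F\in\mathcal{F}$. Germs. For $K\subset\mathbb{C}^n$ bounded, $\mathcal{O}(K)$ is the ring of germs of holomorphic functions on $K$: pairs $(f,\omega)$, $\omega$ an open neighborhood of $K$, $f$ holomorphic on $\omega$, modulo agreement on a smaller open neighborhood of $K$. A locally principal variety in an open set $\omega$ is a closed subset $V\subset\omega$ such that every $z\in\omega$ has a neighborhood $U(z)\subset\omega$ for which $U(z)\cap V$ is the zero set of a single nontrivial holomorphic function on $U(z)$. A germ of an analytic hypersurface in $K$ is an equivalence class of pairs $(V,\omega)$, where $\omega$ is an open neighborhood of $K$ and $V\subsetneq\omega$ is a locally principal variety in $\omega$, two pairs being equivalent if they agree on some open neighborhood of $K$; the set of these is denoted $\mathscr{V}(K)$. $V\in\mathscr{V}(\overline\Omega)$ is irreducible if it is not of the form $V_1\cup V_2$ with $V_1,V_2\in\mathscr{V}(\overline\Omega)$ distinct from $V$. $V$ is minimally defined if it is the zero set of some $\psi\in\mathcal{O}(\overline\Omega)$ such that whenever $U\subset\overline\Omega$ is relatively open and $g\in\mathcal{O}(U)$ vanishes on $U\cap V$, then $\psi|_U$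 divides $g$ in $\mathcal{O}(U)$; such a $\psi$ is called a minimal defining function of $V$ (it is unique up to nonvanishing factors in $\mathcal{O}(\overline\Omega)$). Function spaces. $\mathcal{A}(\Omega,\nu)=\mathcal{O}(\Omega)\cap\mathcal{C}(\Omega\cup T)$, and $\mathfrak{H}^2(\Omega,\nu)$ is the closure of $\mathcal{A}(\Omega,\nu)|_T$ in $L^2(\nu)$. Let $T^*=T\setminus V$. For $k\in\mathbb{N}_0=\{0,1,2,\dots\}$, $\mathcal{A}_k(\Omega^*,\nu)$ is the set of functions $F:\Omega^*\cup T^*\to\mathbb{C}$ such that $F=(\psi^{-k}G)|_{\Omega^*\cup T^*}$ for some $G\in\mathcal{A}(\Omega,\nu)$ and $F|_{T^*}\in L^2(\nu)$, where $\psi$ is a minimal defining function of $V$ (the set is independent of the choice); such $F$ are extended by zero to the $\nu$-null set $T\cap V$. $\mathfrak{H}^2_k(\Omega^*,\nu)$ is the closure of $\mathcal{A}_k(\Omega^*,\nu)|_T$ in $L^2(\nu)$. When $\mathcal{A}(\Omega,\nu)$ is weakly admissible, so is $\mathcal{A}_k(\Omega^*,\nu)$ (with $D=\Omega^*$). Kernels. Let $(D,\mathcal{F},\mathfrak{H})$ be $(\Omega,\mathcal{A}(\Omega,\nu),\mathfrak{H}^2(\Omega,\nu))$ or $(\Omega^*,\mathcal{A}_k(\Omega^*,\nu),\mathfrak{H}^2_k(\Omega^*,\nu))$. For $z\in D$, $\operatorname{Ev}_z:\mathfrak{H}\to\mathbb{C}$ is the unique bounded linear functional with $\operatorname{Ev}_z(F|_T)=F(z)$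 for all $F\in\mathcal{F}$. A function $c:D\times T\to\mathbb{C}$ has the reproducing property for $\mathfrak{H}$ if $\operatorname{Ev}_z(f)=\int_T f(w)\,c(z,w)\,d\nu(w)$ for all $z\in D$ and $f\in\mathfrak{H}$. The Szegő kernel for $\mathfrak{H}$ is the unique function $s:D\times T\to\mathbb{C}$ (unique for each $z$ as an element of $L^2(\nu)$) having the reproducing property for $\mathfrak{H}$ and satisfying $\overline{s(z,\cdot)}\in\mathfrak{H}$ for all $z\in D$. *)

(* Defs.v *)
From HB Require Import structures.
From mathcomp Require Import all_boot all_order all_algebra.
From mathcomp Require Import all_classical all_reals all_analysis.
From mathcomp.real_closed Require Import complex.

Set Implicit Arguments.
Unset Strict Implicit.
Unset Printing Implicit Defensive.

Import Order.TTheory GRing.Theory Num.Theory.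
Import numFieldNormedType.Exports.

Local Open Scope classical_set_scope.
Local Open Scope ring_scope.

(* Bundling R[i] as a numClosedFieldType is what gives it (and the row vectors
   over it) the norm and the topology of MathComp-Analysis. *)
Definition Cplx (R : realType) : numClosedFieldType := (R[i])%type.

Notation Cn R n := 'rV[Cplx R]_n.

(* Real-valued modulus; [`|z|] is the same number seen in R[i]. *)
Definition cmod (R : realType) (z : Cplx R) : R := ComplexField.Normc.normc z.

(* Functions are total; only their values on the relevant set matter. *)

(* Differentiability is over the scalar field R[i], i.e. complex Frechet
   differentiability. Only used for open D. *)
Definition holomorphic_on (R : realType) (n : nat) (D : set (Cn R n))
    (f : Cn R n -> Cplx R) : Prop :=
  forall z, D z -> differentiable f z.

Definition bdry (R : realType) (n : nat) (D : set (Cn R n)) : set (Cn R n) :=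
  closure D `\` interior D.

(* A domain: nonempty, open, connected; here moreover bounded. *)
Definition bounded_domain (R : realType) (n : nat) (D : set (Cn R n)) : Prop :=
  [/\ D !=set0, open D, connected D & bounded_set D].

Section Germs.
Context {R : realType} {n : nat}.
Local Notation Cn := (Cn R n).
Local Notation C := (Cplx R).

(* Representatives (f, omega) of the elements of O(K). The elements of O(K) are
   their classes for [holo_germ_eq]. *)
Record holo_germ (K : set Cn) := HoloGerm {
  hg_fun :> Cn -> C ;
  hg_dom : set Cn ;
  hg_open : open hg_dom ;
  hg_sub : K `<=` hg_dom ;
  hg_holo : holomorphic_on hg_dom hg_fun }.

Definition holo_germ_eq (K : set Cn) (f g : Cn -> C) : Prop :=
  set_nbhs K [set z | f z = g z].

(* U(z) is taken connected, so that "f is nontrivial" means that f does not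
   vanish identically near z. *)
Definition locally_principal (omega V : set Cn) : Prop :=
  [/\ V `<=` omega,
      omega `&` closure V `<=` V &
      forall z, omega z -> exists (U : set Cn) (f : Cn -> C),
        [/\ [/\ open U, connected U, U z & U `<=` omega],
            holomorphic_on U f, (exists2 w, U w & f w != 0) &
            U `&` V = [set w | U w /\ f w = 0]]].

(* Representatives (V, omega) of the elements of V(K), up to [hyp_germ_eq]. *)
Record hyp_germ (K : set Cn) := HypGerm {
  vg_set : set Cn ;
  vg_dom : set Cn ;
  vg_open : open vg_dom ;
  vg_sub : K `<=` vg_dom ;
  vg_principal : locally_principal vg_dom vg_set ;
  vg_proper : vg_set `<` vg_dom }.

Definition hyp_germ_eq (K : set Cn) (V W : set Cn) : Prop :=
  set_nbhs K [set z | V z <-> W z].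

Definition irreducible_germ (K : set Cn) (V : hyp_germ K) : Prop :=
  ~ exists V1 V2 : hyp_germ K,
      [/\ ~ hyp_germ_eq K (vg_set V1) (vg_set V),
          ~ hyp_germ_eq K (vg_set V2) (vg_set V) &
          hyp_germ_eq K (vg_set V) (vg_set V1 `|` vg_set V2)].

Definition relatively_open (K U : set Cn) : Prop :=
  exists2 O : set Cn, open O & U = K `&` O.

(* psi divides g in O(U) *)
Definition germ_divides (U : set Cn) (psi : Cn -> C) (g : holo_germ U) : Prop :=
  exists q : holo_germ U, holo_germ_eq U g (fun z => q z * psi z).

Definition minimal_defining (Omega : set Cn) (V : hyp_germ (closure Omega))
    (psi : holo_germ (closure Omega)) : Prop :=
  hyp_germ_eq (closure Omega) (vg_set V) [set z | psi z = 0] /\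
  forall U : set Cn, relatively_open (closure Omega) U ->
  forall g : holo_germ U, (forall z, (U `&` vg_set V) z -> g z = 0) ->
    germ_divides psi g.

Definition minimally_defined (Omega : set Cn) (V : hyp_germ (closure Omega)) :
    Prop :=
  exists psi : holo_germ (closure Omega), minimal_defining V psi.

End Germs.

(* Finite measures on the Borel sigma-algebra of C^n. *)
Notation borel_Cn R n := (g_sigma_algebraType (@open (Cn R n))).
Notation borel_measure R n := {finite_measure set (borel_Cn R n) -> \bar R}.

Section Spaces.
Context {R : realType} {n : nat}.
Local Notation Cn := (Cn R n).
Local Notation C := (Cplx R).
Implicit Types (nu : borel_measure R n) (D Omega : set Cn).
Implicit Types (FF H : set (Cn -> C)).

Definition measure_on nu (S : set Cn) : Prop := nu (~` S) = 0%E.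

Definition supp nu : set Cn :=
  [set w | forall U : set Cn, open U -> U w -> (0 < nu U)%E].

(* Elements of L^2(nu) are represented by functions, of which only the
   restriction to supp nu matters ([u \_ T] is u on T and 0 elsewhere). *)
Definition inL2 nu (f : Cn -> C) : Prop :=
  ((fun w => complex.Re (f w)) \_ (supp nu) : borel_Cn R n -> R) \in Lfun nu 2%:E /\
  ((fun w => complex.Im (f w)) \_ (supp nu) : borel_Cn R n -> R) \in Lfun nu 2%:E.

Definition L2norm nu (f : Cn -> C) : \bar R :=
  'N[nu]_2%:E[EFin \o ((fun w => cmod (f w)) \_ (supp nu) : borel_Cn R n -> R)]%E.

Definition cintegrable nu (f : Cn -> C) : Prop :=
  nu.-integrable (supp nu) (fun w => (complex.Re (f w))%:E) /\
  nu.-integrable (supp nu) (fun w => (complex.Im (f w))%:E).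

Definition cintegral nu (f : Cn -> C) : C :=
  Complex (Rintegral nu (supp nu) (fun w => complex.Re (f w)))
          (Rintegral nu (supp nu) (fun w => complex.Im (f w))).

Definition weakly_admissible D nu FF : Prop :=
  (forall F, FF F -> inL2 nu F) /\
  (forall K : set Cn, compact K -> K `<=` D ->
    exists2 M : R, 0 < M &
      forall F, FF F -> forall z, K z ->
        ((cmod (F z))%:E <= M%:E * L2norm nu F)%E).

(* The closure in L^2(nu) of the restrictions to supp nu of the members of FF *)
Definition L2closure nu FF : set (Cn -> C) :=
  [set f | inL2 nu f /\
    forall e : R, 0 < e ->
      exists2 F, FF F & (L2norm nu (fun w => f w - F w)%R < e%:E)%E].

Definition holo_cont Omega nu : set (Cn -> C) :=
  [set F | holomorphic_on Omega F /\ {within Omega `|` supp nu, continuous F}].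

Definition hardy Omega nu : set (Cn -> C) := L2closure nu (holo_cont Omega nu).

Definition minus_germ Omega (V : hyp_germ (closure Omega)) : set Cn :=
  Omega `\` vg_set V.

(* A_k(Omega^*, nu), with its members extended by 0 to T `&` V. *)
Definition holo_cont_k Omega nu (V : hyp_germ (closure Omega)) (k : nat) :
    set (Cn -> C) :=
  [set F |
    [/\ exists psi : holo_germ (closure Omega), exists G : Cn -> C,
          [/\ minimal_defining V psi, holo_cont Omega nu G &
              forall z, (minus_germ V `|` (supp nu `\` vg_set V)) z ->
                F z = psi z ^- k * G z],
        forall z, (supp nu `&` vg_set V) z -> F z = 0 &
        inL2 nu F]].

Definition hardy_k Omega nu (V : hyp_germ (closure Omega)) (k : nat) :
    set (Cn -> C) :=
  L2closure nu (holo_cont_k nu V k).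

Definition bounded_linear_on nu H (L : (Cn -> C) -> C) : Prop :=
  (forall (a : C) f g, H f -> H g ->
     L (fun w => a * f w + g w) = a * L f + L g) /\
  (exists M : R, forall f, H f -> ((cmod (L f))%:E <= M%:E * L2norm nu f)%E).

(* In the following, H is the closure of FF in L^2(nu).
   Ev_z: the bounded linear functional on H with Ev_z F = F z for F in FF. *)
Definition Ev nu FF H (z : Cn) : (Cn -> C) -> C :=
  get [set L : (Cn -> C) -> C |
    bounded_linear_on nu H L /\ forall F, FF F -> L F = F z].

(* Integrability is stated because [cintegral] is a total function. *)
Definition reproducing D nu FF H (c : Cn -> Cn -> C) : Prop :=
  forall z, D z -> forall f, H f ->
    cintegrable nu (fun w => f w * c z w) /\
    Ev nu FF H z f = cintegral nu (fun w => f w * c z w).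

(* These two properties determine s z, for z in D, up to a nu-null set. *)
Definition is_szego_kernel D nu FF H (s : Cn -> Cn -> C) : Prop :=
  reproducing D nu FF H s /\
  forall z, D z -> H (fun w => conjc (s z w)).

End Spaces.

(* Main.v *)
(* Integration against c_k(z, .) is a bounded functional on L^2(nu), because phi
   is continuous on the compact set T; it therefore suffices to test it on A_k.
   If F = psi^-k G is in A_k, then phi^k F agrees nu-almost everywhere with the
   function h^k G of A, which s reproduces; dividing by phi(z)^k gives F(z). That
   s reproduces the values of the members of A (and not only those of the
   functional Ev_z, which is obtained by a choice operator) requires the existence
   of a bounded extension of the evaluation at z, which is where weak
   admissibility enters.
   If moreover |phi| = r on T, then conj(phi) = r^2 / phi there, so that
   conj(c_k(z, .)) is a multiple of phi^-k conj(s(z, .)); when G in A approximates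
   conj(s(z, .)), the function phi^-k G = psi^-k h^-k G is in A_k. The case r = 0
   is degenerate: T is then contained in V, and nu(T) = 0. *)

Require Import Defs.
From HB Require Import structures.
From mathcomp Require Import all_boot all_order all_algebra.
From mathcomp Require Import all_classical all_reals all_analysis.
From mathcomp.real_closed Require Import complex.
From mathcomp Require Import measurable_realfun ring lra.

Set Implicit Arguments.
Unset Strict Implicit.
Unset Printing Implicit Defensive.

Import Order.TTheory GRing.Theory Num.Theory.
Import numFieldNormedType.Exports.
Local Open Scope classical_set_scope.
Local Open Scope ring_scope.

(** * Modulus and conjugation *)

Section Modulus.
Context {R : realType}.
Implicit Types z w : Cplx R.

Lemma cmod_ge0 z : 0 <= cmod z.
Proof. by case: z => a b; exact: sqrtr_ge0. Qed.

Lemma cmod0 : cmod (0 : Cplx R) = 0.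
Proof. exact: ComplexField.Normc.normc0. Qed.

Lemma cmodD z w : cmod (z + w) <= cmod z + cmod w.
Proof. exact: le_normcD. Qed.

Lemma cmodM z w : cmod (z * w) = cmod z * cmod w.
Proof. exact: ComplexField.Normc.normcM. Qed.

Lemma cmodX z k : cmod (z ^+ k) = cmod z ^+ k.
Proof.
elim: k => [|k IH]; first exact: ComplexField.Normc.normc1.
by rewrite !exprS cmodM IH.
Qed.

Lemma cmodN z : cmod (- z) = cmod z.
Proof. exact: normcN. Qed.

Lemma cmod_eq0 z : cmod z = 0 -> z = 0.
Proof. exact: ComplexField.Normc.eq0_normc. Qed.

Lemma cmod_conj z : cmod (conjc z : Cplx R) = cmod z.
Proof. by case: z => a b; rewrite /cmod /= sqrrN. Qed.

Lemma sqr_cmod z : cmod z ^+ 2 = complex.Re z ^+ 2 + complex.Im z ^+ 2.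
Proof. by case: z => a b; rewrite /cmod /= sqr_sqrtr// addr_ge0 ?sqr_ge0. Qed.

Lemma Re_le_cmod z : `|complex.Re z| <= cmod z.
Proof.
by rewrite -ler_sqr ?nnegrE ?cmod_ge0// sqr_cmod real_normK ?num_real// lerDl sqr_ge0.
Qed.

Lemma Im_le_cmod z : `|complex.Im z| <= cmod z.
Proof.
by rewrite -ler_sqr ?nnegrE ?cmod_ge0// sqr_cmod real_normK ?num_real// lerDr sqr_ge0.
Qed.

Lemma cmod_le_ReIm z : cmod z <= `|complex.Re z| + `|complex.Im z|.
Proof.
rewrite -ler_sqr ?nnegrE ?cmod_ge0 ?addr_ge0// sqr_cmod sqrrD !real_normK ?num_real//.
by rewrite -addrA lerD2l lerDr mulrn_wge0// mulr_ge0.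
Qed.

Lemma norm_cmod z : `|z| = real_complex R (cmod z).
Proof. by case: z => a b; rewrite normc_def. Qed.

Lemma mulr_conj z : z * (conjc z : Cplx R) = real_complex R (cmod z ^+ 2).
Proof.
by rewrite rmorphXn /= -norm_cmod; exact/esym/(@sqr_normc R).
Qed.

Lemma Re_add z w : complex.Re (z + w) = complex.Re z + complex.Re w.
Proof. by case: z w => ? ? []. Qed.
Lemma Im_add z w : complex.Im (z + w) = complex.Im z + complex.Im w.
Proof. by case: z w => ? ? []. Qed.
Lemma Re_opp z : complex.Re (- z) = - complex.Re z. Proof. by case: z. Qed.
Lemma Im_opp z : complex.Im (- z) = - complex.Im z. Proof. by case: z. Qed.
Lemma Re_mul z w : complex.Re (z * w) =
  complex.Re z * complex.Re w - complex.Im z * complex.Im w.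
Proof. by case: z w => ? ? []. Qed.
Lemma Im_mul z w : complex.Im (z * w) =
  complex.Re z * complex.Im w + complex.Im z * complex.Re w.
Proof. by case: z w => ? ? []. Qed.

Lemma conjcM z w : (conjc (z * w) : Cplx R) = conjc z * (conjc w : Cplx R).
Proof. exact: (rmorphM (@conjc R)). Qed.

Lemma conjcX z k : (conjc (z ^+ k) : Cplx R) = (conjc z : Cplx R) ^+ k.
Proof. exact: (rmorphXn (@conjc R)). Qed.

End Modulus.

(** * The space L^2(nu) *)

(** Squaring the pointwise bound and integrating gives the inequality between the squared norms.
    Every later norm comparison goes through this one; the case [B = 0] shows that functions
    vanishing almost everywhere have norm zero. *)
Lemma ae_le_Lnorm2 d (T : measurableType d) (R : realType)
    (mu : {measure set T -> \bar R}) (f g : T -> R) (B : R) :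
  0 <= B -> measurable_fun setT f -> measurable_fun setT g ->
  {ae mu, forall x, `|f x| <= B * `|g x|} ->
  ('N[mu]_2%:E[EFin \o f] <= B%:E * 'N[mu]_2%:E[EFin \o g])%E.
Proof.
move=> B0 mf mg fg.
have mX (u : T -> R) : measurable_fun setT u ->
    measurable_fun setT ((fun x => (`|u x| `^ 2)%:E) : T -> \bar R).
  move=> mu0; apply/measurable_EFinP.
  apply/(@measurableT_comp _ _ _ _ _ _ (fun x : R => x `^ 2)%R) => //.
  exact/measurableT_comp.
rewrite unlock /=.
(* Written as a square root, [B] can be moved under the outer root and then into the integral as
   [B ^ 2]. *)
have -> : B%:E = ((B `^ 2)%:E `^ 2^-1)%E.
  by rewrite poweR_EFin -powRrM mulfV// powRr1.
rewrite -poweRM ?lee_fin ?powR_ge0//; last by apply: integral_ge0 => x _; rewrite lee_fin powR_ge0.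
have E (u : T -> R) : (fun x => (`|(EFin \o u) x| `^ 2)%E) = (fun x => (`|u x| `^ 2)%:E).
  by apply/funext => x /=.
rewrite (E f) (E g).
rewrite -ge0_integralZl//; last 2 first.
- exact: mX.
- by rewrite lee_fin powR_ge0.
apply: gt0_ler_poweR => //.
- by rewrite in_itv/= leey andbT integral_ge0// => x _; rewrite lee_fin powR_ge0.
- rewrite in_itv/= leey andbT integral_ge0// => x _.
  by rewrite -EFinM lee_fin mulr_ge0// powR_ge0.
apply: ae_ge0_le_integral => //.
- exact: mX.
- by move=> x _; rewrite -EFinM lee_fin mulr_ge0// powR_ge0.
- by apply: measurable_funeM; exact: mX.
case: fg => N [mN N0 fgN]; exists N; split => // x /= nP; apply: fgN => /= le1.
apply: nP => _; rewrite -EFinM lee_fin -powRM//.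
by apply: ge0_ler_powR => //; rewrite nnegrE ?mulr_ge0.
Qed.

Section L2.
Context {R : realType} {n : nat}.
Variable nu : borel_measure R n.
Local Notation Cn := (Cn R n).
Local Notation C := (Cplx R).
Local Notation T := (supp nu).
Local Notation TB := (supp nu : set (borel_Cn R n)).
Implicit Types f g : Cn -> C.

Lemma open_measurable_Cn (U : set Cn) : open U -> measurable (U : set (borel_Cn R n)).
Proof. by move=> oU; apply: sub_sigma_algebra. Qed.

Lemma closed_measurable_Cn (U : set Cn) : closed U -> measurable (U : set (borel_Cn R n)).
Proof.
move=> cU; rewrite -(setCK U); apply: measurableC.
by apply: open_measurable_Cn; exact: closed_openC.
Qed.

Lemma supp_closed : closed T.
Proof.
move=> w Tw U oU Uw.
have /Tw[x [Tx Ux]] : nbhs w U by exact: open_nbhs_nbhs.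
exact: Tx.
Qed.

Lemma measurable_supp : measurable (T : set (borel_Cn R n)).
Proof. exact: closed_measurable_Cn supp_closed. Qed.

(** Measurability is asked on the support only, in keeping with [inL2], which ignores values
    elsewhere. *)
Definition meas_supp f : Prop :=
  measurable_fun TB ((fun w => complex.Re (f w)) : borel_Cn R n -> R) /\
  measurable_fun TB ((fun w => complex.Im (f w)) : borel_Cn R n -> R).

Lemma meas_suppD f g : meas_supp f -> meas_supp g -> meas_supp (fun w => f w + g w).
Proof.
move=> [f1 f2] [g1 g2]; split.
- by under eq_fun do rewrite Re_add; exact: measurable_funD.
- by under eq_fun do rewrite Im_add; exact: measurable_funD.
Qed.

Lemma meas_suppM f g : meas_supp f -> meas_supp g -> meas_supp (fun w => f w * g w).
Proof.
move=> [f1 f2] [g1 g2]; split.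
- by under eq_fun do rewrite Re_mul; apply: measurable_funB; exact: measurable_funM.
- by under eq_fun do rewrite Im_mul; apply: measurable_funD; exact: measurable_funM.
Qed.

Lemma meas_supp_cst (a : C) : meas_supp (fun=> a).
Proof. by split; exact: measurable_cst. Qed.

Lemma meas_suppX f k : meas_supp f -> meas_supp (fun w => f w ^+ k).
Proof.
move=> mf; elim: k => [|k IH]; first exact: meas_supp_cst.
by under eq_fun do rewrite exprS; exact: meas_suppM.
Qed.

Lemma meas_supp_conj f : meas_supp f -> meas_supp (fun w => conjc (f w)).
Proof.
move=> [f1 f2]; split.
- by under eq_fun => w do have -> : complex.Re (conjc (f w)) = complex.Re (f w) by case: (f w).
- under eq_fun => w do have -> : complex.Im (conjc (f w)) = - complex.Im (f w) by case: (f w).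
  exact: measurableT_comp.
Qed.

Lemma meas_supp_ext f g : (forall w, T w -> f w = g w) -> meas_supp f -> meas_supp g.
Proof.
move=> fg [f1 f2]; split.
- apply: eq_measurable_fun f1 => w; rewrite inE => /fg -> //.
- apply: eq_measurable_fun f2 => w; rewrite inE => /fg -> //.
Qed.

Lemma measurable_cmod f : meas_supp f ->
  measurable_fun TB ((fun w => cmod (f w)) : borel_Cn R n -> R).
Proof.
move=> [f1 f2].
have -> : (fun w => cmod (f w)) =
    Num.sqrt \o (fun w => complex.Re (f w) ^+ 2 + complex.Im (f w) ^+ 2).
  by apply/funext => w /=; rewrite -sqr_cmod sqrtr_sqr ger0_norm ?cmod_ge0.
apply: measurableT_comp; first exact: continuous_measurable_fun (@sqrt_continuous R).
by apply: measurable_funD; exact: measurable_funX.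
Qed.

Lemma measurable_cmod_patch f : meas_supp f ->
  measurable_fun setT ((fun w => cmod (f w)) \_ TB : borel_Cn R n -> R).
Proof. by move/measurable_cmod/(measurable_restrictT _ measurable_supp). Qed.

(** Off the support both patched moduli are zero, so domination is needed only on it. *)
Lemma ae_le_L2norm f g (B : R) : 0 <= B -> meas_supp f -> meas_supp g ->
  {ae nu, forall w : borel_Cn R n, T w -> cmod (f w) <= B * cmod (g w)} ->
  (L2norm nu f <= B%:E * L2norm nu g)%E.
Proof.
move=> B0 mf mg fg; apply: ae_le_Lnorm2 => //.
- exact: measurable_cmod_patch.
- exact: measurable_cmod_patch.
case: fg => N [mN N0 fgN]; exists N; split => // x /= nP; apply: fgN => /= le1.
apply: nP; rewrite !patchE; case: ifPn => [|_]; last by rewrite normr0 mulr0.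
by rewrite inE => Tx; rewrite !ger0_norm ?cmod_ge0//; exact: le1.
Qed.

Lemma L2norm_ge0 f : (0 <= L2norm nu f)%E.
Proof. exact: Lnorm_ge0. Qed.

Lemma inL2_meas f : inL2 nu f -> meas_supp f.
Proof.
move=> [f1 f2]; split; apply/(measurable_restrictT _ measurable_supp).
  by move: f1; rewrite inE => /andP[+ _]; rewrite inE.
by move: f2; rewrite inE => /andP[+ _]; rewrite inE.
Qed.

Lemma L2normD f g : meas_supp f -> meas_supp g ->
  (L2norm nu (fun w => f w + g w)%R <= L2norm nu f + L2norm nu g)%E.
Proof.
move=> mf mg.
have mf' := measurable_cmod_patch mf.
have mg' := measurable_cmod_patch mg.
have mfg' := measurable_cmod_patch (meas_suppD mf mg).
apply: le_trans (@minkowski_EFin _ _ _ nu _ _ 2 mf' mg' _); last by rewrite ler1n.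
rewrite -[leRHS]mul1e; apply: ae_le_Lnorm2 => //.
  exact: measurable_funD.
apply: aeW => x; rewrite mul1r /= !patchE; case: ifPn => _; last by rewrite addr0.
by rewrite !ger0_norm ?addr_ge0 ?cmod_ge0// cmodD.
Qed.

(** The modulus dominates [|Re f|] and [|Im f|] and is dominated by their sum. Square integrability
    of the two parts thus becomes finiteness of a single norm. *)
Lemma inL2P f : inL2 nu f <-> meas_supp f /\ (L2norm nu f < +oo)%E.
Proof.
split=> [fL2|[mf foo]].
- have mf := inL2_meas fL2; split => //; case: fL2.
  have [/(measurable_restrictT _ measurable_supp) m1
        /(measurable_restrictT _ measurable_supp) m2] := mf.
  rewrite !inE => /andP[_ +] /andP[_]; rewrite !inE /= /finite_norm => f1 f2.
  apply: le_lt_trans (lte_add_pinfty f1 f2).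
  (* Absolute values do not change the two norms, and Minkowski then bounds the norm of
     [|Re f| + |Im f|], which dominates the modulus. *)
  rewrite -(Lnorm_abse nu (EFin \o (_ \_ _))).
  rewrite -(Lnorm_abse nu (EFin \o ((fun w => complex.Im _) \_ _))).
  have E (u : borel_Cn R n -> R) : abse \o (EFin \o u) = EFin \o (fun x => `|u x|) by [].
  rewrite !E.
  have m1' : measurable_fun setT
      (fun w => `|((fun w => complex.Re (f w)) \_ T : borel_Cn R n -> R) w|).
    exact: measurableT_comp.
  have m2' : measurable_fun setT
      (fun w => `|((fun w => complex.Im (f w)) \_ T : borel_Cn R n -> R) w|).
    exact: measurableT_comp.
  apply: le_trans (@minkowski_EFin _ _ _ nu _ _ 2 m1' m2' _); last by rewrite ler1n.
  rewrite -[leRHS]mul1e; apply: ae_le_Lnorm2 => //.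
  + exact: measurable_cmod_patch.
  + exact: measurable_funD.
  apply: aeW => x; rewrite mul1r /= !patchE; case: ifPn => _; last by rewrite normr0 addr0.
  by rewrite ger0_norm ?cmod_ge0// [leRHS]ger0_norm ?addr_ge0// cmod_le_ReIm.
- have [/(measurable_restrictT _ measurable_supp) m1
        /(measurable_restrictT _ measurable_supp) m2] := mf.
  split; rewrite inE; apply/andP; rewrite !inE; split => //=; rewrite /finite_norm;
  apply: le_lt_trans foo; rewrite -[leRHS]mul1e; apply: ae_le_Lnorm2 => //;
  try exact: measurable_cmod_patch.
  + apply: aeW => x; rewrite mul1r /= !patchE; case: ifPn => _ //.
    by rewrite [leRHS]ger0_norm ?cmod_ge0// Re_le_cmod.
  + apply: aeW => x; rewrite mul1r /= !patchE; case: ifPn => _ //.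
    by rewrite [leRHS]ger0_norm ?cmod_ge0// Im_le_cmod.
Qed.
End L2.

(** * The real-valued norm, Hölder's inequality and the integral pairing *)

Section L2norm.
Context {R : realType} {n : nat}.
Variable nu : borel_measure R n.
Local Notation Cn := (Cn R n).
Local Notation C := (Cplx R).
Local Notation T := (supp nu).
Local Notation TB := (supp nu : set (borel_Cn R n)).
Implicit Types f g : Cn -> C.

(** [fine] sends an infinite norm to 0, so this value is meaningful only under [inL2 nu f]. *)
Definition L2normr f : R := fine (L2norm nu f).

Lemma L2normrE f : inL2 nu f -> L2norm nu f = (L2normr f)%:E.
Proof.
by move=> /inL2P[_ foo]; rewrite /L2normr fineK// ge0_fin_numE// L2norm_ge0.
Qed.

Lemma L2normr_ge0 f : 0 <= L2normr f.
Proof. by rewrite fine_ge0// L2norm_ge0. Qed.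

Lemma inL2_le_ae f g (B : R) : 0 <= B -> meas_supp nu f -> inL2 nu g ->
  {ae nu, forall w : borel_Cn R n, T w -> cmod (f w) <= B * cmod (g w)} ->
  inL2 nu f /\ L2normr f <= B * L2normr g.
Proof.
move=> B0 mf g2 fg; have mg := inL2_meas g2.
have le := ae_le_L2norm B0 mf mg fg.
have f2 : inL2 nu f.
  by apply/inL2P; split => //; apply: (le_lt_trans le); rewrite L2normrE// -EFinM ltry.
by split => //; rewrite -lee_fin EFinM -!L2normrE.
Qed.

Lemma inL2_le f g (B : R) : 0 <= B -> meas_supp nu f -> inL2 nu g ->
  (forall w, T w -> cmod (f w) <= B * cmod (g w)) ->
  inL2 nu f /\ L2normr f <= B * L2normr g.
Proof. by move=> B0 mf g2 fg; apply: inL2_le_ae => //; exact: aeW. Qed.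

Lemma inL2_ext f g : (forall w, T w -> f w = g w) -> inL2 nu f -> inL2 nu g.
Proof.
move=> fg f2; apply: (inL2_le (B := 1) _ _ f2 _).1 => //.
  by apply: meas_supp_ext fg _; exact: inL2_meas.
by move=> w Tw; rewrite mul1r fg.
Qed.

Lemma L2normr_ext f g : (forall w, T w -> f w = g w) -> L2normr f = L2normr g.
Proof.
move=> fg; rewrite /L2normr /L2norm; congr (fine (Lnorm _ _ _)).
by apply/funext => w /=; rewrite !patchE; case: ifPn => //; rewrite inE => /fg ->.
Qed.

Lemma inL2D f g : inL2 nu f -> inL2 nu g -> inL2 nu (fun w => f w + g w).
Proof.
move=> f2 g2; apply/inL2P; split; first by apply: meas_suppD; exact: inL2_meas.
apply: le_lt_trans (L2normD (inL2_meas f2) (inL2_meas g2)) _.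
by rewrite !L2normrE// -EFinD ltry.
Qed.

Lemma L2normrD f g : inL2 nu f -> inL2 nu g ->
  L2normr (fun w => f w + g w) <= L2normr f + L2normr g.
Proof.
move=> f2 g2; rewrite -lee_fin EFinD -!L2normrE//; last exact: inL2D.
by apply: L2normD; exact: inL2_meas.
Qed.

Lemma inL2M_bounded phi f (B : R) : 0 <= B -> meas_supp nu phi -> inL2 nu f ->
  (forall w, T w -> cmod (phi w) <= B) ->
  inL2 nu (fun w => phi w * f w) /\ L2normr (fun w => phi w * f w) <= B * L2normr f.
Proof.
move=> B0 mphi f2 phiB; apply: inL2_le => //.
  by apply: meas_suppM => //; exact: inL2_meas.
by move=> w Tw; rewrite cmodM ler_wpM2r ?cmod_ge0// phiB.
Qed.

Lemma inL2Z (a : C) f : inL2 nu f -> inL2 nu (fun w => a * f w).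
Proof.
by move=> f2; apply: (inL2M_bounded (cmod_ge0 a) (meas_supp_cst nu a) f2 _).1.
Qed.

Lemma L2normrZ (a : C) f : inL2 nu f -> L2normr (fun w => a * f w) <= cmod a * L2normr f.
Proof.
by move=> f2; apply: (inL2M_bounded (cmod_ge0 a) (meas_supp_cst nu a) f2 _).2.
Qed.

Lemma inL2B f g : inL2 nu f -> inL2 nu g -> inL2 nu (fun w => f w - g w).
Proof.
move=> f2 g2; apply: (inL2_ext (f := fun w => f w + (-1) * g w)).
  by move=> w _; rewrite mulN1r.
by apply: inL2D => //; exact: inL2Z.
Qed.

Lemma L2normr_distC f g : L2normr (fun w => f w - g w) = L2normr (fun w => g w - f w).
Proof.
rewrite /L2normr /L2norm; congr (fine (Lnorm _ _ _)).
by apply/funext => w /=; rewrite !patchE; case: ifPn => // _; rewrite -cmodN opprB.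
Qed.

Lemma L2normr_dist_triangle f g u : inL2 nu f -> inL2 nu g -> inL2 nu u ->
  L2normr (fun w => f w - u w) <= L2normr (fun w => f w - g w) + L2normr (fun w => g w - u w).
Proof.
move=> f2 g2 u2; apply: le_trans (L2normrD _ _); [|exact: inL2B|exact: inL2B].
by rewrite le_eqVlt; apply/orP; left; apply/eqP/L2normr_ext => w _; rewrite addrA subrK.
Qed.

Lemma inL2_0 : inL2 nu (fun=> 0).
Proof.
apply/inL2P; split; first exact: meas_supp_cst.
rewrite /L2norm (_ : EFin \o _ = cst 0%E); first by rewrite Lnorm0.
by apply/funext => w; congr EFin; rewrite patchE; case: ifP => _ //; exact: cmod0.
Qed.

Lemma L2normr_eq0 f : (forall w, T w -> f w = 0) -> L2normr f = 0.
Proof.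
move=> f0; rewrite (@L2normr_ext _ (fun=> 0))//.
rewrite /L2normr /L2norm (_ : EFin \o _ = cst 0%E); first by rewrite Lnorm0.
by apply/funext => w; congr EFin; rewrite patchE; case: ifP => _ //; exact: cmod0.
Qed.

(** This is Hölder's inequality with both exponents equal to 2; the finite right-hand side also
    yields integrability. *)
Lemma integrable_cmodM f g : inL2 nu f -> inL2 nu g ->
  nu.-integrable TB (EFin \o ((fun w => cmod (f w) * cmod (g w)) : borel_Cn R n -> R)) /\
  (\int[nu]_(w in TB) (cmod (f w) * cmod (g w))%:E <= (L2normr f * L2normr g)%:E)%E.
Proof.
move=> f2 g2.
have mf := inL2_meas f2; have mg := inL2_meas g2.
have le : (\int[nu]_(w in TB) (cmod (f w) * cmod (g w))%:E <= (L2normr f * L2normr g)%:E)%E.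
  rewrite EFinM -!L2normrE//.
  apply: le_trans (@hoelder _ _ _ nu _ _ 2 2 (measurable_cmod_patch mf)
    (measurable_cmod_patch mg) _ _ _) => //; last by rewrite [RHS]splitr !div1r.
  rewrite Lnorm1 [leLHS]integral_mkcond le_eqVlt; apply/orP; left; apply/eqP.
  apply: eq_integral => x _ /=; rewrite !patchE; case: ifPn => _.
    by rewrite ger0_norm// mulr_ge0 ?cmod_ge0.
  by rewrite mulr0 normr0.
split => //; apply/integrableP; split.
  by apply/measurable_EFinP; apply: measurable_funM; exact: measurable_cmod.
apply: le_lt_trans (ltry (L2normr f * L2normr g)); apply: le_trans le.
rewrite le_eqVlt; apply/orP; left; apply/eqP.
by apply: eq_integral => x _ /=; rewrite ger0_norm// mulr_ge0 ?cmod_ge0.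
Qed.

Lemma Rintegral_le_L2normr f g (u : borel_Cn R n -> R) : inL2 nu f -> inL2 nu g ->
  measurable_fun TB u -> (forall w, T w -> `|u w| <= cmod (f w) * cmod (g w)) ->
  nu.-integrable TB (EFin \o u) /\ `|Rintegral nu TB u| <= L2normr f * L2normr g.
Proof.
move=> f2 g2 mu ule; have [fgi fgle] := integrable_cmodM f2 g2.
have ui : nu.-integrable TB (EFin \o u).
  apply: le_integrable fgi => //; first exact: measurable_supp.
    exact/measurable_EFinP.
  move=> w Tw /=; rewrite lee_fin (ger0_norm (mulr_ge0 (cmod_ge0 _) (cmod_ge0 _))).
  exact: ule.
split => //.
have mT := @measurable_supp _ _ nu.
rewrite -lee_fin EFin_normr_Rintegral//.
apply: le_trans (le_abse_integral nu mT _) _; first exact/measurable_EFinP.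
apply: le_trans fgle.
apply: ge0_le_integral => //.
- by apply/measurable_EFinP; exact: measurableT_comp.
- by apply/measurable_EFinP; apply: measurable_funM; apply: measurable_cmod; exact: inL2_meas.
Qed.

Lemma cintegrableM f g : inL2 nu f -> inL2 nu g -> cintegrable nu (fun w => f w * g w).
Proof.
move=> f2 g2.
have [m1 m2] := meas_suppM (inL2_meas f2) (inL2_meas g2).
split.
- by apply: (Rintegral_le_L2normr f2 g2 m1 _).1 => w _; rewrite -cmodM Re_le_cmod.
- by apply: (Rintegral_le_L2normr f2 g2 m2 _).1 => w _; rewrite -cmodM Im_le_cmod.
Qed.

(** The real and imaginary parts of the integral are bounded separately, each by the Cauchy-Schwarz
    inequality, whence the factor 2. *)
Lemma cintegralM_le f g : inL2 nu f -> inL2 nu g ->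
  cmod (cintegral nu (fun w => f w * g w)) <= 2 * (L2normr f * L2normr g).
Proof.
move=> f2 g2.
have [m1 m2] := meas_suppM (inL2_meas f2) (inL2_meas g2).
apply: le_trans (cmod_le_ReIm _) _; rewrite mulr_natl mulr2n; apply: lerD => /=.
- by apply: (Rintegral_le_L2normr f2 g2 m1 _).2 => w _; rewrite -cmodM Re_le_cmod.
- by apply: (Rintegral_le_L2normr f2 g2 m2 _).2 => w _; rewrite -cmodM Im_le_cmod.
Qed.

Lemma cintegralD f g : cintegrable nu f -> cintegrable nu g ->
  cintegral nu (fun w => f w + g w) = cintegral nu f + cintegral nu g.
Proof.
move=> [f1 f2] [g1 g2]; rewrite /cintegral; congr Complex.
- rewrite -(RintegralD (@measurable_supp _ _ nu) f1 g1).
  by apply: eq_Rintegral => w _; rewrite Re_add.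
- rewrite -(RintegralD (@measurable_supp _ _ nu) f2 g2).
  by apply: eq_Rintegral => w _; rewrite Im_add.
Qed.

Lemma cintegralZ (a : C) f : cintegrable nu f ->
  cintegral nu (fun w => a * f w) = a * cintegral nu f.
Proof.
move=> [f1 f2]; have mT := @measurable_supp _ _ nu.
have i1 (c : R) := integrableZl mT c f1; have i2 (c : R) := integrableZl mT c f2.
case: a => a b; rewrite /cintegral; congr Complex => /=.
- rewrite -(RintegralZl a mT f1) -(RintegralZl b mT f2).
  rewrite -(RintegralB mT (i1 a) (i2 b)).
  by apply: eq_Rintegral => w _; rewrite Re_mul.
- rewrite -(RintegralZl b mT f1) -(RintegralZl a mT f2).
  rewrite -(RintegralD mT (i2 a) (i1 b)).
  by apply: eq_Rintegral => w _; rewrite Im_mul.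
Qed.

Lemma eq_cintegral f g : (forall w, T w -> f w = g w) -> cintegral nu f = cintegral nu g.
Proof.
move=> fg; rewrite /cintegral; congr Complex; apply: eq_Rintegral => w; rewrite inE => Tw;
by rewrite fg.
Qed.

End L2norm.

(** * Evaluation functionals on L^2-closures *)

(** If [x] were positive, [e = x / (2 (B + 1))] would give [x <= x / 2] at most. Identities and
    bounds on an L^2-closure are proved with this, from approximations within an arbitrary [e]. *)
Lemma le0_eps (R : realType) (x B : R) : 0 <= B ->
  (forall e, 0 < e -> x <= B * e) -> x <= 0.
Proof.
move=> B0 xB; rewrite leNgt; apply/negP => x0.
have B1 : 0 < 2 * (B + 1) by rewrite mulr_gt0// ltr_wpDl.
have := xB _ (divr_gt0 x0 B1); rewrite mulrA ler_pdivlMr// => h.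
have : 0 <= B * x by rewrite mulr_ge0// ltW.
by nra.
Qed.

Section Evaluation.
Context {R : realType} {n : nat}.
Variable nu : borel_measure R n.
Local Notation Cn := (Cn R n).
Local Notation C := (Cplx R).
Local Notation T := (supp nu).
Variable FF : set (Cn -> C).
Hypothesis FF_inL2 : forall F, FF F -> inL2 nu F.
Hypothesis FF_lin : forall (a : C) F G, FF F -> FF G -> FF (fun w => a * F w + G w).
Local Notation H := (L2closure nu FF).
Implicit Types f g F G : Cn -> C.

Lemma L2closure_approx f e : H f -> 0 < e ->
  exists2 F, FF F & L2normr nu (fun w => f w - F w) < e.
Proof.
move=> [f2 fa] e0; have [F FFF Fe] := fa _ e0; exists F => //.
by rewrite -lte_fin -L2normrE//; apply: inL2B => //; exact: FF_inL2.
Qed.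

Lemma L2closure_intro f : inL2 nu f ->
  (forall e, 0 < e -> exists2 F, FF F & L2normr nu (fun w => f w - F w) < e) -> H f.
Proof.
move=> f2 fa; split => // e e0; have [F FFF Fe] := fa _ e0; exists F => //.
by rewrite L2normrE ?lte_fin//; apply: inL2B => //; exact: FF_inL2.
Qed.

Lemma sub_L2closure F : FF F -> H F.
Proof.
move=> FFF; apply: L2closure_intro; first exact: FF_inL2.
by move=> e e0; exists F => //; rewrite L2normr_eq0// => w _; rewrite subrr.
Qed.

Lemma L2normr_lin_dist (a : C) f g F G : inL2 nu f -> inL2 nu g -> inL2 nu F -> inL2 nu G ->
  L2normr nu (fun w => (a * f w + g w) - (a * F w + G w)) <=
  cmod a * L2normr nu (fun w => f w - F w) + L2normr nu (fun w => g w - G w).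
Proof.
move=> f2 g2 F2 G2; have fF := inL2B f2 F2; have gG := inL2B g2 G2.
rewrite (@L2normr_ext _ _ _ _ (fun w => a * (f w - F w) + (g w - G w))); last first.
  by move=> w _; ring.
by apply: le_trans (L2normrD (inL2Z a fF) gG) _; rewrite lerD2r; exact: L2normrZ.
Qed.

Lemma L2closure_lin (a : C) f g : H f -> H g -> H (fun w => a * f w + g w).
Proof.
move=> Hf Hg; have f2 := Hf.1; have g2 := Hg.1.
apply: L2closure_intro; first by apply: inL2D => //; exact: inL2Z.
move=> e e0; have a1 : 0 < cmod a + 1 by rewrite ltr_wpDl// cmod_ge0.
(* The error on [f] is multiplied by [cmod a] and the error on [g] by 1, so the two add up to [e];
   the [1] also keeps the divisor positive when [a = 0]. *)
have e1 : 0 < e / (cmod a + 1) by rewrite divr_gt0.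
have [F FFF Fe] := L2closure_approx Hf e1.
have [G FFG Ge] := L2closure_approx Hg e1.
exists (fun w => a * F w + G w); first exact: FF_lin.
apply: (le_lt_trans (L2normr_lin_dist a f2 g2 (FF_inL2 FFF) (FF_inL2 FFG))).
have -> : e = cmod a * (e / (cmod a + 1)) + e / (cmod a + 1).
  by rewrite -{2}[e / _]mul1r -mulrDl mulrC divfK// gt_eqF.
by apply: ler_ltD => //; rewrite ler_wpM2l ?cmod_ge0// ltW.
Qed.

(** The constant in [bounded_linear_on] may be negative; its absolute value still serves as a
    bound. *)
Lemma bounded_linear_L2normr L : bounded_linear_on nu H L ->
  exists2 M : R, 0 <= M & forall f, H f -> cmod (L f) <= M * L2normr nu f.
Proof.
move=> [_ [M LM]]; exists `|M| => // f Hf.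
have := LM _ Hf; rewrite L2normrE; last by case: Hf.
rewrite -EFinM lee_fin => /le_trans; apply.
by rewrite ler_wpM2r ?L2normr_ge0// ler_norm.
Qed.

Lemma bounded_linear_dist L f F : bounded_linear_on nu H L -> H f -> H F ->
  L f - L F = L (fun w => (-1) * F w + f w).
Proof. by move=> [lin _] Hf HF; rewrite lin// mulN1r addrC. Qed.

(** Density: for [F] in [FF] close to [f], both [L f - L F] and [L' f - L' F] are small by
    boundedness, and [L F = L' F]. *)
Lemma bounded_linear_unique L L' f :
  bounded_linear_on nu H L -> bounded_linear_on nu H L' ->
  (forall F, FF F -> L F = L' F) -> H f -> L f = L' f.
Proof.
move=> bL bL' LL' Hf; have [M M0 LM] := bounded_linear_L2normr bL.
have [M' M'0 L'M] := bounded_linear_L2normr bL'.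
apply/eqP; rewrite -subr_eq0; apply/eqP/cmod_eq0/eqP; rewrite eq_le cmod_ge0 andbT.
apply: (@le0_eps _ _ (M + M')); first exact: addr_ge0.
move=> e e0; have [F FFF Fe] := L2closure_approx Hf e0.
have HF := sub_L2closure FFF; have HfF := L2closure_lin (-1) HF Hf.
have -> : L f - L' f = (L f - L F) + - (L' f - L' F) by rewrite (LL' F)//; ring.
apply: le_trans (cmodD _ _) _; rewrite cmodN !bounded_linear_dist// mulrDl.
have E : L2normr nu (fun w => -1 * F w + f w) <= e.
  apply: ltW; apply: le_lt_trans Fe.
  by rewrite (@L2normr_ext _ _ _ _ (fun w => f w - F w))// => w _; rewrite mulN1r addrC.
apply: lerD; [apply: le_trans (LM _ HfF) _|apply: le_trans (L'M _ HfF) _];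
  by rewrite ler_wpM2l.
Qed.

(** The choice operator in [Ev] returns some bounded functional as soon as one candidate exists, and
    uniqueness identifies it with that candidate on the closure. *)
Lemma Ev_eq (z : Cn) L f : bounded_linear_on nu H L ->
  (forall F, FF F -> L F = F z) -> H f -> Ev nu FF H z f = L f.
Proof.
move=> bL LF Hf; rewrite /Ev; case: xgetP => [L' _ [bL' L'F]|/(_ L)].
  by apply: bounded_linear_unique => // F FFF; rewrite L'F// LF.
by case; split.
Qed.

(* McShane's formula extends a real-valued Lipschitz function from FF to L^2. *)
Lemma lipschitz_extension (rho : (Cn -> C) -> R) (M : R) : 0 <= M ->
  (forall F G, FF F -> FF G -> rho F - rho G <= M * L2normr nu (fun w => F w - G w)) ->
  exists p : (Cn -> C) -> R, forall f F, inL2 nu f -> FF F ->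
    `|p f - rho F| <= M * L2normr nu (fun w => f w - F w).
Proof.
move=> M0 rhoM.
pose S f := [set rho F + M * L2normr nu (fun w => f w - F w) | F in FF].
exists (fun f => inf (S f)) => f F f2 FFF.
(* The Lipschitz bound and the triangle inequality bound [S f] below, so its infimum is a genuine
   one. This lower bound gives one half of the estimate; the element of [S f] coming from [F] gives
   the other. *)
have lbS : lbound (S f) (rho F - M * L2normr nu (fun w => f w - F w)).
  move=> _ [G FFG <-]; rewrite lerBlDr -addrA -mulrDr -lerBlDl.
  apply: le_trans (rhoM _ _ FFF FFG) _; rewrite ler_wpM2l// addrC (L2normr_distC _ f F).
  by apply: L2normr_dist_triangle => //; exact: FF_inL2.
rewrite ler_norml; apply/andP; split.
  rewrite lerBrDl; apply: lb_le_inf => //.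
  by exists (rho F + M * L2normr nu (fun w => f w - F w)); exists F.
rewrite lerBlDl; apply: ge_inf; last by exists F.
by exists (rho F - M * L2normr nu (fun w => f w - F w)).
Qed.

(** A bounded functional extending the evaluation has to be exhibited. The real and imaginary parts
    of the evaluation are Lipschitz on [FF] and are extended separately; linearity and boundedness
    of the result on the closure then follow from density. *)
Lemma Ev_sub (z : Cn) (M : R) F : 0 <= M ->
  (forall F, FF F -> cmod (F z) <= M * L2normr nu F) -> FF F -> Ev nu FF H z F = F z.
Proof.
move=> M0 zM FFF.
have FFB G G' : FF G -> FF G' -> cmod (G z - G' z) <= M * L2normr nu (fun w => G w - G' w).
  move=> FG FG'; have /zM := FF_lin (-1) FG' FG.
  rewrite mulN1r addrC => /le_trans; apply; rewrite ler_wpM2l//.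
  by rewrite (@L2normr_ext _ _ _ _ (fun w => G w - G' w))// => w _; rewrite mulN1r addrC.
have [p pP] : exists p : (Cn -> C) -> R, forall f F, inL2 nu f -> FF F ->
    `|p f - complex.Re (F z)| <= M * L2normr nu (fun w => f w - F w).
  apply: (lipschitz_extension M0) => G G' FG FG'; apply: le_trans (FFB _ _ FG FG').
  by rewrite -Re_opp -Re_add; apply: le_trans (Re_le_cmod _); exact: ler_norm.
have [q qP] : exists q : (Cn -> C) -> R, forall f F, inL2 nu f -> FF F ->
    `|q f - complex.Im (F z)| <= M * L2normr nu (fun w => f w - F w).
  apply: (lipschitz_extension M0) => G G' FG FG'; apply: le_trans (FFB _ _ FG FG').
  by rewrite -Im_opp -Im_add; apply: le_trans (Im_le_cmod _); exact: ler_norm.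
pose L f : C := Complex (p f) (q f).
have LF f G : inL2 nu f -> FF G -> cmod (L f - G z) <= 2 * M * L2normr nu (fun w => f w - G w).
  move=> f2 FG; apply: le_trans (cmod_le_ReIm _) _.
  rewrite !Re_add !Im_add Re_opp Im_opp /= mulr_natl mulr2n mulrDl.
  by apply: lerD; [exact: pP|exact: qP].
have LFE G : FF G -> L G = G z.
  move=> FG; apply/eqP; rewrite -subr_eq0; apply/eqP/cmod_eq0/eqP.
  rewrite eq_le cmod_ge0 andbT; apply: le_trans (LF _ _ (FF_inL2 FG) FG) _.
  by rewrite L2normr_eq0 ?mulr0// => w _; rewrite subrr.
rewrite -(LFE F)//; apply: Ev_eq => //; last exact: sub_L2closure.
split => [a f g Hf Hg|].
- apply/eqP; rewrite -subr_eq0; apply/eqP/cmod_eq0/eqP; rewrite eq_le cmod_ge0 andbT.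
  (* With [f] and [g] approximated within [e], the term [L u] contributes at most [2 M (|a| + 1) e],
     and [a * L f + L g] contributes the same amount. *)
  apply: (@le0_eps _ _ (4 * M * (cmod a + 1))).
    by rewrite !mulr_ge0// addr_ge0// cmod_ge0.
  move=> e e0; have [F1 FF1 F1e] := L2closure_approx Hf e0.
  have [G1 FG1 G1e] := L2closure_approx Hg e0.
  have [f2 g2] := (Hf.1, Hg.1).
  set u := fun w => _ + _.
  have u2 : inL2 nu u by apply: inL2D => //; exact: inL2Z.
  have -> : L u - (a * L f + L g) = (L u - (a * F1 z + G1 z)) +
    (- (a * (L f - F1 z)) + - (L g - G1 z)) by ring.
  apply: le_trans (cmodD _ _) _.
  have -> : 4 * M * (cmod a + 1) * e = 2 * M * ((cmod a * e) + e) +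
    (cmod a * (2 * M * e) + 2 * M * e) by ring.
  have M2 : 0 <= 2 * M by rewrite mulr_ge0.
  apply: lerD.
    apply: le_trans (LF _ _ u2 (FF_lin a FF1 FG1)) _; rewrite ler_wpM2l//.
    apply: le_trans (L2normr_lin_dist a f2 g2 (FF_inL2 FF1) (FF_inL2 FG1)) _.
    by apply: lerD; [rewrite ler_wpM2l ?cmod_ge0// ltW|exact: ltW].
  apply: le_trans (cmodD _ _) _; rewrite !cmodN cmodM; apply: lerD.
    rewrite ler_wpM2l ?cmod_ge0//; apply: le_trans (LF _ _ f2 FF1) _.
    by rewrite ler_wpM2l// ltW.
  by apply: le_trans (LF _ _ g2 FG1) _; rewrite ler_wpM2l// ltW.
- exists M => f Hf; have f2 := Hf.1; rewrite L2normrE// -EFinM lee_fin -subr_le0.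
  (* Replacing [L f] by [F1 z] costs [2 M e], and comparing the norm of [F1] with that of [f] costs
     [M e]; in the limit the original constant [M] survives. *)
  apply: (@le0_eps _ _ (3 * M)); first by rewrite mulr_ge0.
  move=> e e0; have [F1 FF1 F1e] := L2closure_approx Hf e0.
  rewrite lerBlDr.
  have -> : L f = (L f - F1 z) + F1 z by ring.
  apply: le_trans (cmodD _ _) _.
  have h1 : cmod (L f - F1 z) <= 2 * M * e.
    by apply: le_trans (LF _ _ f2 FF1) _; rewrite ler_wpM2l ?mulr_ge0// ltW.
  have h2 : cmod (F1 z) <= M * (e + L2normr nu f).
    apply: le_trans (zM _ FF1) _; rewrite ler_wpM2l//.
    have -> : L2normr nu F1 = L2normr nu (fun w => (F1 w - f w) + f w).
      by apply: L2normr_ext => w _; rewrite subrK.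
    apply: le_trans (L2normrD (inL2B (FF_inL2 FF1) f2) f2) _; rewrite lerD2r.
    by rewrite L2normr_distC ltW.
  apply: le_trans (lerD h1 h2) _; rewrite le_eqVlt; apply/orP; left; apply/eqP; ring.
Qed.

(* Testing a kernel on FF is enough: integration against it is bounded by Hoelder. *)
Lemma reproducing_of_FF (D : set Cn) (c : Cn -> Cn -> C) :
  (forall z, D z -> inL2 nu (c z)) ->
  (forall z, D z -> forall F, FF F -> cintegral nu (fun w => F w * c z w) = F z) ->
  reproducing D nu FF H c.
Proof.
move=> c2 cF z Dz f Hf; have cz2 := c2 _ Dz; have f2 := Hf.1.
split; first exact: cintegrableM.
apply: (Ev_eq (L := fun f => cintegral nu (fun w => f w * c z w))) => //; last exact: cF.
split => [a g h Hg Hh|].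
- have [g2 h2] := (Hg.1, Hh.1).
  have ig := cintegrableM g2 cz2; have ih := cintegrableM h2 cz2.
  rewrite -(cintegralZ a ig) -cintegralD//; last first.
    rewrite (_ : (fun w => _) = (fun w => (a * g w) * c z w)).
      by apply: cintegrableM => //; exact: inL2Z.
    by apply/funext => w; rewrite mulrA.
  by apply: eq_cintegral => w _; ring.
- exists (2 * L2normr nu (c z)) => g Hg; have g2 := Hg.1.
  rewrite L2normrE// -EFinM lee_fin; apply: le_trans (cintegralM_le g2 cz2) _.
  by rewrite -mulrA (mulrC (L2normr _ g)).
Qed.

End Evaluation.

(** * Compactness in C^n *)

Section Topology.
Context {R : realType} {n : nat}.
Local Notation Cn := (Cn R n).
Local Notation C := (Cplx R).

(** In the order of [R[i]] a positive element has zero imaginary part, so radii for the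
    [R[i]]-valued norm may be taken real. *)
Lemma pos_Cplx (e : C) : 0 < e -> exists2 r : R, 0 < r & e = real_complex R r.
Proof. by case: e => a b; rewrite ltcE /= => /andP[/eqP -> a0]; exists a. Qed.

Lemma cmod_dist (z w : C) : `|cmod z - cmod w| <= cmod (z - w).
Proof.
have h (x y : C) : cmod x - cmod y <= cmod (x - y).
  by rewrite lerBlDr; apply: le_trans (cmodD _ _); rewrite subrK.
rewrite ler_norml h andbT lerNl opprB; apply: le_trans (h _ _) _.
by rewrite -cmodN opprB.
Qed.

Lemma cmod_continuous : continuous (@cmod R : C -> R).
Proof.
move=> z; apply/(@cvgrPdist_lt _ R^o C (nbhs z)) => e e0.
apply/nbhs_normP; exists (real_complex R e) => /=; first by rewrite ltcR.
by move=> w /=; rewrite norm_cmod ltcR; apply: le_lt_trans; exact: cmod_dist.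
Qed.

Lemma Complex_continuous : continuous (fun p : R * R => (Complex p.1 p.2 : C)).
Proof.
move=> p; apply/(@cvgrPdist_lt _ C (R * R)%type (nbhs p)) => e /pos_Cplx[r r0 ->].
have r20 : 0 < r / 2 by rewrite divr_gt0.
have c1 : fst @ nbhs p --> p.1 by exact: cvg_fst.
have c2 : snd @ nbhs p --> p.2 by exact: cvg_snd.
have near1 := (@cvgrPdist_lt _ R^o (R * R)%type (nbhs p) (nbhs_filter p) fst p.1).1 c1 _ r20.
have near2 := (@cvgrPdist_lt _ R^o (R * R)%type (nbhs p) (nbhs_filter p) snd p.2).1 c2 _ r20.
apply: filterS2 near1 near2 => q /= h1 h2.
rewrite norm_cmod ltcR; apply: le_lt_trans (cmod_le_ReIm _) _.
by rewrite Re_add Im_add Re_opp Im_opp /= [r]splitr ltrD.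
Qed.

Lemma compact_square (B : R) :
  compact [set z : C | `|complex.Re z| <= B /\ `|complex.Im z| <= B].
Proof.
rewrite (_ : [set z : C | _] =
    (fun p : R * R => (Complex p.1 p.2 : C)) @` (`[- B, B] `*` `[- B, B])).
  apply: continuous_compact; last by apply: compact_setX; exact: segment_compact.
  by apply: continuous_subspaceT; exact: Complex_continuous.
apply/seteqP; split => [[a b]/= [ha hb]|_ [[a b] /= [ha hb] <-]] /=.
  by exists (a, b) => //=; rewrite !in_itv /= -!ler_norml.
by move: ha hb; rewrite !in_itv /= -!ler_norml.
Qed.

(* Heine-Borel in C^n; the library has it over the real numbers only. *)
Lemma bounded_closure_compact (D : set Cn) : bounded_set D -> compact (closure D).
Proof.
move=> [M [Mreal DM]].
(* The bound [M] is a real element of [R[i]], and boundedness speaks of radii strictly above it,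
   hence the [+ 1]. *)
pose B := complex.Re M + 1.
pose A := [set z : C | `|complex.Re z| <= B /\ `|complex.Im z| <= B].
pose K := [set v : Cn | forall i, A (v ord0 i)].
have cK : compact K := @rV_compact C n (fun=> A) (fun=> @compact_square B).
have closedK : closed K by apply: compact_closed cK; exact: norm_hausdorff.
apply: subclosed_compact (@closed_closure _ _) cK _.
rewrite [X in _ `<=` X]((closure_id K).1 closedK); apply: closure_subset => v Dv i.
have vM : `|v| <= real_complex R B.
  apply: DM Dv; move: Mreal; rewrite /B; case: (M) => a b.
  rewrite complex_real /= => /eqP ->.
  by rewrite ltcR ltrDl.
have viB : cmod (v ord0 i) <= B.
  rewrite -lecR -norm_cmod; apply: le_trans vM.
  (* The norm of a row vector is the maximum of the moduli of its entries. *)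
  have : `|v ord0 i|%:nng <= \big[Order.max/0%:nng]_ij `|v ij.1 ij.2|%:nng.
    by apply/bigmax_geP; right; exists (ord0, i).
  by rewrite -num_le.
by split; apply: le_trans viB; [exact: Re_le_cmod|exact: Im_le_cmod].
Qed.

Lemma compact_cmod_bounded (K : set Cn) (f : Cn -> C) : compact K ->
  {within K, continuous f} -> exists2 B : R, 0 <= B & forall w, K w -> cmod (f w) <= B.
Proof.
move=> cK cf.
have : compact ((@cmod R : C -> R) @` (f @` K)).
  apply: continuous_compact; first by apply: continuous_subspaceT; exact: cmod_continuous.
  exact: continuous_compact.
move=> /compact_bounded[M [Mreal KM]]; exists (`|M| + 1) => [|w Kw].
  by rewrite addr_ge0.
rewrite -[leLHS]ger0_norm ?cmod_ge0//; apply: (KM (`|M| + 1)).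
  by rewrite (le_lt_trans (ler_norm _))// ltrDl.
by exists (f w) => //; exists w.
Qed.

End Topology.

(** * The spaces A and A_k *)

Section HoloCont.
Context {R : realType} {n : nat}.
Local Notation Cn := (Cn R n).
Local Notation C := (Cplx R).
Variables (Omega : set Cn) (nu : borel_measure R n).
Local Notation A := (holo_cont Omega nu).
Implicit Types F G : Cn -> C.

Lemma holo_cont_cst (a : C) : A (fun=> a).
Proof.
split; first by move=> z _; exact: differentiable_cst.
by apply: continuous_subspaceT; exact: cst_continuous.
Qed.

Lemma holo_contD F G : A F -> A G -> A (fun z => F z + G z).
Proof.
move=> [hF cF] [hG cG]; split.
  by move=> z Oz; apply: differentiableD; [exact: hF|exact: hG].
apply/subspace_continuousP => z Oz.
apply: cvgD; first exact: ((subspace_continuousP _ _).1 cF z Oz).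
exact: ((subspace_continuousP _ _).1 cG z Oz).
Qed.

Lemma holo_contM F G : A F -> A G -> A (fun z => F z * G z).
Proof.
move=> [hF cF] [hG cG]; split.
  by move=> z Oz; apply: differentiableM; [exact: hF|exact: hG].
apply/subspace_continuousP => z Oz.
apply: cvgM; first exact: ((subspace_continuousP _ _).1 cF z Oz).
exact: ((subspace_continuousP _ _).1 cG z Oz).
Qed.

Lemma holo_contX F k : A F -> A (fun z => F z ^+ k).
Proof.
move=> AF; elim: k => [|k IH]; first exact: holo_cont_cst.
rewrite (_ : (fun z => _) = (fun z => F z * F z ^+ k)); first exact: holo_contM.
by apply/funext => z; rewrite exprS.
Qed.

Lemma holo_contV F : A F -> (forall z, (Omega `|` supp nu) z -> F z != 0) ->
  A (fun z => (F z)^-1).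
Proof.
move=> [hF cF] F0; split.
  by move=> z Oz; apply: differentiableV; [exact: hF|apply: F0; left].
apply/subspace_continuousP => z Oz.
by apply: cvgV; [exact: F0|exact: ((subspace_continuousP _ _).1 cF z Oz)].
Qed.

End HoloCont.

(** * Minimal defining functions and the spaces [holo_cont_k] *)

Section Germs.
Context {R : realType} {n : nat}.
Local Notation Cn := (Cn R n).
Local Notation C := (Cplx R).
Variables (Omega : set Cn) (nu : borel_measure R n).
Variable V : hyp_germ (closure Omega).
Hypothesis hnu : measure_on nu (bdry Omega).
Local Notation T := (supp nu).
Local Notation A := (holo_cont Omega nu).

(** A point outside the closure has the complement of the closure as an open neighbourhood, and that
    set misses the boundary, so it is null. *)
Lemma supp_sub_closure : T `<=` closure Omega.
Proof.
move=> w Tw; apply: contrapT => nw.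
have oU : open (~` closure Omega) by apply: closed_openC; exact: closed_closure.
have := Tw _ oU nw; apply/negP; rewrite -leNgt -hnu.
apply: le_measure; rewrite ?inE.
- exact: open_measurable_Cn.
- apply: measurableC; apply: measurableD; [apply: closed_measurable_Cn|apply: open_measurable_Cn].
    exact: closed_closure.
  exact: open_interior.
- by move=> x nx bx; exact: (nx (proj1 bx)).
Qed.

Lemma domain_sub_closure z : (Omega `|` T) z -> closure Omega z.
Proof. by move=> [/subset_closure//|/supp_sub_closure]. Qed.

(** The germ is holomorphic on a neighbourhood of the closure, which contains both [Omega] and the
    support. *)
Lemma holo_cont_germ (q : holo_germ (closure Omega)) : A q.
Proof.
split.
  by move=> z Oz; apply: hg_holo; apply: hg_sub; exact: subset_closure.
apply/subspace_continuousP => z Oz; apply: cvg_within_filter.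
apply: differentiable_continuous; apply: hg_holo; apply: hg_sub.
exact: domain_sub_closure.
Qed.

Lemma minimal_defining_zeros (psi : holo_germ (closure Omega)) z :
  minimal_defining V psi -> closure Omega z -> vg_set V z <-> psi z = 0.
Proof. by move=> [Vpsi _] /Vpsi /nbhs_singleton. Qed.

(** Minimality of [psi'] is applied on the whole closure to [psi], which vanishes on [V]. *)
Lemma minimal_defining_divides (psi psi' : holo_germ (closure Omega)) :
  minimal_defining V psi -> minimal_defining V psi' ->
  exists q : holo_germ (closure Omega),
    forall z, closure Omega z -> psi z = q z * psi' z.
Proof.
move=> mpsi [_ /(_ (closure Omega)) div].
have [|z [Kz Vz]|q qE] := div _ psi.
- by exists setT; rewrite ?setIT//; exact: openT.
- exact/(minimal_defining_zeros mpsi Kz).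
- by exists q => z /qE /nbhs_singleton.
Qed.

Lemma domain_k_sub z : (minus_germ V `|` (T `\` vg_set V)) z -> (Omega `|` T) z.
Proof. by move=> [[Oz _]|[Tz _]]; [left|right]. Qed.

Lemma domain_k_neq0 (psi : holo_germ (closure Omega)) z : minimal_defining V psi ->
  (minus_germ V `|` (T `\` vg_set V)) z -> psi z != 0.
Proof.
move=> mpsi Dz; apply/eqP => psi0.
have Kz := domain_sub_closure (domain_k_sub Dz).
by case: Dz => -[_]; apply; exact/(minimal_defining_zeros mpsi Kz).
Qed.

(* The minimal defining function may be fixed once and for all, since any other
   one divides it. *)
Lemma holo_cont_kE (psi : holo_germ (closure Omega)) k F :
  minimal_defining V psi -> holo_cont_k nu V k F ->
  exists2 G, A G & forall z, (minus_germ V `|` (T `\` vg_set V)) z ->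
    F z = psi z ^- k * G z.
Proof.
move=> mpsi [[psi' [G [mpsi' AG FE]]] _ _].
have [q qE] := minimal_defining_divides mpsi mpsi'.
(* From [psi = q * psi'] one gets [psi' ^- k = q ^+ k * psi ^- k] off [V], where [q] has no zeros
   because [psi] has none. *)
exists (fun z => q z ^+ k * G z).
  by apply: holo_contM _ AG; apply: holo_contX; exact: (holo_cont_germ q).
move=> z Dz; rewrite FE// qE; last exact: (domain_sub_closure (domain_k_sub Dz)).
have := domain_k_neq0 mpsi Dz; rewrite qE; last exact: (domain_sub_closure (domain_k_sub Dz)).
rewrite mulf_eq0 => /norP[q0 psi'0].
by rewrite exprMn invfM mulrA -[_ * q z ^+ k]mulrAC mulVf ?mul1r// expf_neq0.
Qed.

(** Both members are first written over the same power of [psi], so that their numerators can be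
    combined. *)
Lemma holo_cont_k_lin (psi : holo_germ (closure Omega)) k (a : C) F G :
  minimal_defining V psi -> holo_cont_k nu V k F -> holo_cont_k nu V k G ->
  holo_cont_k nu V k (fun z => a * F z + G z).
Proof.
move=> mpsi AF AG.
have [F1 AF1 FE] := holo_cont_kE mpsi AF; have [G1 AG1 GE] := holo_cont_kE mpsi AG.
have [[_ F0 F2] [_ G0 G2]] := (AF, AG); split.
- exists psi, (fun z => a * F1 z + G1 z); split; first exact: mpsi.
    apply: holo_contD _ AG1; apply: holo_contM _ AF1; exact: holo_cont_cst.
  by move=> z Dz; rewrite FE// GE// mulrDr mulrCA.
- by move=> z Dz; rewrite F0// G0// mulr0 addr0.
- by apply: inL2D => //; exact: inL2Z.
Qed.

End Germs.

(** * The kernels *)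

Section Kernel.
Context {R : realType} {n : nat}.
Local Notation Cn := (Cn R n).
Local Notation C := (Cplx R).
Variables (Omega : set Cn) (nu : borel_measure R n).
Variable V : hyp_germ (closure Omega).
Hypothesis hOmega : bounded_domain Omega.
Hypothesis hnu : measure_on nu (bdry Omega).
Hypothesis VT : nu (supp nu `&` vg_set V) = 0%E.
Hypothesis adm : weakly_admissible Omega nu (holo_cont Omega nu).
Variable s : Cn -> Cn -> C.
Hypothesis hs : is_szego_kernel Omega nu (holo_cont Omega nu) (hardy Omega nu) s.
Variables (phi h : Cn -> C) (psi : holo_germ (closure Omega)).
Hypothesis Aphi : holo_cont Omega nu phi.
Hypothesis mpsi : minimal_defining V psi.
Hypothesis Ah : holo_cont Omega nu h.
Hypothesis phiE : forall z, (Omega `|` supp nu) z -> phi z = h z * psi z.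
Hypothesis hV : forall z, ((Omega `|` supp nu) `\` vg_set V) z -> h z != 0.
Local Notation T := (supp nu).
Local Notation A := (holo_cont Omega nu).

Lemma holo_cont_inL2 F : A F -> inL2 nu F.
Proof. exact: adm.1. Qed.

Lemma holo_cont_lin (a : C) F G : A F -> A G -> A (fun w => a * F w + G w).
Proof.
move=> AF AG; apply: holo_contD _ AG; apply: holo_contM _ AF.
exact: holo_cont_cst.
Qed.

(** Weak admissibility for the compact set [{z}] gives the bound that [Ev_sub] requires. *)
Lemma Ev_holo_cont z G : Omega z -> A G -> Ev nu A (hardy Omega nu) z G = G z.
Proof.
move=> Oz AG; have [||M M0 zM] := adm.2 [set z]; first exact: compact_set1.
  by move=> _ ->.
apply: (Ev_sub holo_cont_inL2 holo_cont_lin (ltW M0) _ AG) => F AF.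
by rewrite -lee_fin EFinM -L2normrE; [exact: zM|exact: holo_cont_inL2].
Qed.

(** The definition places the conjugate of [s z] in the Hardy space; conjugation preserves modulus
    and measurability. *)
Lemma szego_inL2 z : Omega z -> inL2 nu (s z).
Proof.
move=> /hs.2[s2 _].
apply: (inL2_le (B := 1) _ _ s2 _).1 => // [|w _]; last by rewrite mul1r cmod_conj.
apply: (meas_supp_ext (f := fun w => conjc (conjc (s z w)))).
  by move=> w _; exact: conjcK.
by apply: meas_supp_conj; exact: inL2_meas.
Qed.

Lemma szego_integral z G : Omega z -> A G ->
  cintegral nu (fun w => G w * s z w) = G z.
Proof.
move=> Oz AG; rewrite -(Ev_holo_cont Oz AG).
by have [_ ->] := hs.1 z Oz G (sub_L2closure holo_cont_inL2 AG).
Qed.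

(** The support is closed in the closure of a bounded set, hence compact. *)
Lemma phi_bounded : exists2 B : R, 0 <= B & forall w, T w -> cmod (phi w) <= B.
Proof.
apply: compact_cmod_bounded.
- apply: (@subclosed_compact _ _ (closure Omega)).
  + exact: supp_closed.
  + by case: hOmega => _ _ _; exact: bounded_closure_compact.
  + exact: supp_sub_closure.
- apply: continuous_subspaceW Aphi.2; exact: subsetUr.
Qed.

Lemma phi_neq0 z : minus_germ V z -> phi z != 0.
Proof.
move=> Dz; have Oz : (Omega `|` T) z by left; case: Dz.
rewrite phiE// mulf_neq0//; last by apply: (domain_k_neq0 hnu mpsi); left.
by apply: hV; split => //; case: Dz.
Qed.

Let c (k : nat) (z w : Cn) : C := phi w ^+ k / phi z ^+ k * s z w.

Lemma phiX_inL2 k F : inL2 nu F -> inL2 nu (fun w => phi w ^+ k * F w).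
Proof.
move=> F2; have [B B0 phiB] := phi_bounded.
apply: (inL2M_bounded (exprn_ge0 k B0) _ F2 _).1.
  by apply: meas_suppX; exact/inL2_meas/holo_cont_inL2.
by move=> w Tw; rewrite cmodX lerXn2r ?nnegrE ?cmod_ge0 ?phiB.
Qed.

Lemma kernel_inL2 k z : minus_germ V z -> inL2 nu (c k z).
Proof.
move=> [Oz _]; apply: (inL2_ext (f := fun w => (phi z ^+ k)^-1 * (phi w ^+ k * s z w))).
  by move=> w _; rewrite /c mulrA [_^-1 * _]mulrC.
by apply: inL2Z; apply: phiX_inL2; exact: szego_inL2.
Qed.

Lemma holo_cont_k_inL2 k F : holo_cont_k nu V k F -> inL2 nu F.
Proof. by case. Qed.

(** The witness must be measurable: [V] is relatively closed in a neighbourhood of the closure of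
    [Omega], so its trace on the support is closed. *)
Lemma null_supp_germ : {ae nu, forall w : borel_Cn R n, T w -> ~ vg_set V w}.
Proof.
exists (T `&` vg_set V); split => //; last first.
  by move=> w /= /not_implyP[Tw /contrapT Vw].
apply: closed_measurable_Cn.
have -> : T `&` vg_set V = T `&` closure (vg_set V).
  apply/seteqP; split => w [Tw Vw]; split => //; first exact: subset_closure.
  have [_ cV _] := vg_principal V; apply: cV; split => //.
  by apply: vg_sub; exact: (supp_sub_closure hnu).
by apply: closedI; [exact: supp_closed|exact: closed_closure].
Qed.

Lemma kernel_integral k z F : minus_germ V z -> holo_cont_k nu V k F ->
  cintegral nu (fun w => F w * c k z w) = F z.
Proof.
move=> Dz AF; have Oz : Omega z by case: Dz.
have s2 := szego_inL2 Oz; have F2 := holo_cont_k_inL2 AF.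
have [G AG FE] := holo_cont_kE hnu mpsi AF.
have AhG : A (fun w => h w ^+ k * G w) by apply: holo_contM _ AG; exact: holo_contX.
have hGE w : (minus_germ V `|` (T `\` vg_set V)) w -> phi w ^+ k * F w = h w ^+ k * G w.
  move=> Dw; rewrite FE// phiE; last exact: (domain_k_sub Dw).
  have psi0 := domain_k_neq0 hnu mpsi Dw.
  by rewrite exprMn mulrA mulfK// expf_neq0.
have pF2 := phiX_inL2 k F2; have hG2 := holo_cont_inL2 AhG.
have d2 := inL2B pF2 hG2.
(* On the part of the support inside [V], [F] is 0 while [h ^+ k * G] need not be. The two functions
   agree only almost everywhere, and domination with constant 0 gives norm zero. *)
have d0 : L2normr nu (fun w => phi w ^+ k * F w - h w ^+ k * G w) = 0.
  apply/eqP; rewrite eq_le L2normr_ge0 andbT -(mul0r (L2normr nu (fun=> 0))).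
  apply: (inL2_le_ae (lexx 0) (inL2_meas d2) (inL2_0 nu) _).2.
  case: null_supp_germ => N [mN N0 NV]; exists N; split => // w /= nw; apply: NV => /= Vw.
  apply: nw => Tw; rewrite mul0r hGE ?subrr ?cmod0//.
  by right; split => //; exact: Vw.
have I1 : cintegral nu (fun w => (phi w ^+ k * F w - h w ^+ k * G w) * s z w) = 0.
  apply: cmod_eq0; apply/eqP; rewrite eq_le cmod_ge0 andbT.
  by apply: le_trans (cintegralM_le d2 s2) _; rewrite d0 mul0r mulr0.
have I2 : cintegral nu (fun w => (phi w ^+ k * F w) * s z w) = h z ^+ k * G z.
  rewrite -(szego_integral Oz AhG) -[RHS]add0r -I1 -cintegralD; [|exact: cintegrableM..].
  by apply: eq_cintegral => w _; rewrite mulrBl subrK.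
have -> : cintegral nu (fun w => F w * c k z w) =
    cintegral nu (fun w => (phi z ^+ k)^-1 * ((phi w ^+ k * F w) * s z w)).
  by apply: eq_cintegral => w _; rewrite /c; ring.
rewrite cintegralZ; last exact: cintegrableM.
rewrite I2 -hGE; last by left.
by rewrite mulrA mulVf ?mul1r// expf_neq0// phi_neq0.
Qed.

Lemma kernel_reproducing k :
  reproducing (minus_germ V) nu (holo_cont_k nu V k) (hardy_k nu V k) (c k).
Proof.
apply: reproducing_of_FF.
- exact: holo_cont_k_inL2.
- by move=> a F G; exact: (holo_cont_k_lin hnu a mpsi).
- exact: kernel_inL2.
- by move=> z Dz F AF; exact: kernel_integral.
Qed.

Lemma kernel_conj_hardy (r : R) k z : (forall z, (Omega `|` T) z -> h z != 0) ->
  (forall w, T w -> cmod (phi w) = r) -> minus_germ V z ->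
  hardy_k nu V k (fun w => conjc (c k z w)).
Proof.
move=> h0 phir Dz; have Oz : Omega z by case: Dz.
have [S2 _] := hs.2 z Oz.
pose b : C := conjc (phi z ^+ k)^-1.
have cE w : conjc (c k z w) = b * (conjc (phi w) : C) ^+ k * conjc (s z w).
  by rewrite /c conjcM [_ / _]mulrC conjcM conjcX.
have mphi : meas_supp nu phi by exact/inL2_meas/holo_cont_inL2.
have mb : meas_supp nu (fun w => b * (conjc (phi w) : C) ^+ k).
  apply: meas_suppM; first exact: meas_supp_cst.
  by apply: meas_suppX; exact: meas_supp_conj.
(* If the support is empty, [r] is arbitrary and may be negative; [|r|] keeps the bound
   nonnegative. *)
have bB w : T w -> cmod (b * (conjc (phi w) : C) ^+ k) <= cmod b * `|r| ^+ k.
  move=> Tw; rewrite cmodM cmodX cmod_conj phir// ler_wpM2l ?cmod_ge0//.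
  by rewrite -normrX ler_norm.
have B0 : 0 <= cmod b * `|r| ^+ k by rewrite mulr_ge0 ?cmod_ge0 ?exprn_ge0.
have bM := inL2M_bounded B0 mb _ bB.
have c2 : inL2 nu (fun w => conjc (c k z w)).
  by apply: (inL2_ext _ (bM _ S2).1) => w _; rewrite cE.
apply: L2closure_intro => //; first exact: holo_cont_k_inL2.
move=> e e0; have [r0|r0] := eqVneq r 0.
  (* Here [phi], and hence [psi], vanishes on the support, which therefore lies in the null set
     inside [V]; the zero function is at distance 0. *)
  exists (fun=> 0).
    split => //; last exact: inL2_0.
    exists psi, (fun=> 0); split; [exact: mpsi|exact: holo_cont_cst|].
    by move=> w _; rewrite mulr0.
  apply: le_lt_trans e0; rewrite -(mul0r (L2normr nu (fun=> 0))).
  have d2 := inL2B c2 (inL2_0 nu).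
  apply: (inL2_le_ae (lexx 0) (inL2_meas d2) (inL2_0 nu) _).2.
  case: null_supp_germ => N [mN N0 NV]; exists N; split => // w /= nw; apply: NV => /= Vw.
  apply: nw => Tw; exfalso; apply: (Vw Tw).
  have Dw : (Omega `|` T) w by right.
  apply/(minimal_defining_zeros mpsi (domain_sub_closure hnu Dw)).
  have : phi w = 0 by apply: cmod_eq0; rewrite phir.
  by rewrite phiE// => /eqP; rewrite mulf_eq0 (negbTE (h0 _ Dw)) => /eqP.
(* For [r] nonzero the support does not meet [V]. *)
have TV w : T w -> psi w != 0.
  move=> Tw; apply: contra_neq r0 => psi0.
  by rewrite -(phir _ Tw) phiE ?psi0 ?mulr0 ?cmod0//; right.
(* The multiplier of [conjc (s z w) - G w] is bounded by [cmod b * |r| ^+ k]; adding 1 makes the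
   final estimate strict. *)
have D0 : 0 < cmod b * `|r| ^+ k + 1 by rewrite ltr_wpDl.
have [G AG Ge] := L2closure_approx holo_cont_inL2 (hs.2 z Oz) (divr_gt0 e0 D0).
have G2 := holo_cont_inL2 AG.
(* On [T], [conjc phi = r ^ 2 / phi] because [cmod phi = r]. *)
pose a : C := b * (real_complex R (r ^+ 2) : C) ^+ k.
pose F w := psi w ^- k * (a * (h w)^-1 ^+ k * G w).
have FE w : T w -> F w = b * (conjc (phi w) : C) ^+ k * G w.
  move=> Tw; have Dw : (Omega `|` T) w by right.
  have phi0 : phi w != 0 by rewrite phiE// mulf_neq0 ?h0 ?TV.
  have -> : (conjc (phi w) : C) = (real_complex R (r ^+ 2) : C) / phi w.
    by rewrite -(phir _ Tw) -mulr_conj mulrAC mulfV// mul1r.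
  by rewrite /F /a phiE// expr_div_n exprMn invfM exprVn; ring.
exists F.
  split.
  - exists psi, (fun w => a * (h w)^-1 ^+ k * G w); split; [exact: mpsi| |by []].
    apply: holo_contM _ AG; apply: holo_contM; first exact: holo_cont_cst.
    by apply: holo_contX; exact: holo_contV.
  (* The prescribed zero values concern no point, since the support misses [V]. *)
  - move=> w [Tw Vw]; have /eqP[] := TV _ Tw.
    by apply/(minimal_defining_zeros mpsi (supp_sub_closure hnu Tw)).
  - by apply: (inL2_ext _ (bM _ G2).1) => w Tw; rewrite FE.
rewrite (L2normr_ext
  (g := fun w => b * (conjc (phi w) : C) ^+ k * (conjc (s z w) - G w))); last first.
  by move=> w Tw; rewrite cE FE// -mulrBr.
apply: le_lt_trans (bM _ (inL2B S2 G2)).2 _.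
apply: (@le_lt_trans _ _ (cmod b * `|r| ^+ k * (e / (cmod b * `|r| ^+ k + 1)))).
  by rewrite ler_wpM2l// ltW.
by rewrite mulrA ltr_pdivrMr// [ltRHS]mulrC ltr_pM2r// ltrDl.
Qed.

End Kernel.

Theorem proposition3p14 (R : realType) (n : nat)
  (Omega : set (Cn R n)) (hOmega : bounded_domain Omega)
  (nu : borel_measure R n) (hnu : measure_on nu (bdry Omega))
  (V : hyp_germ (closure Omega))
  (Virr : irreducible_germ V) (Vmin : minimally_defined V)
  (VOmega : Omega `&` vg_set V !=set0)
  (VT : nu (supp nu `&` vg_set V) = 0%E)
  (adm : weakly_admissible Omega nu (holo_cont Omega nu))
  (s : Cn R n -> Cn R n -> Cplx R)
  (hs : is_szego_kernel Omega nu (holo_cont Omega nu) (hardy Omega nu) s)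
  (phi h : Cn R n -> Cplx R) (psi : holo_germ (closure Omega))
  (Aphi : holo_cont Omega nu phi) (hpsi : minimal_defining V psi)
  (Ah : holo_cont Omega nu h)
  (phiE : forall z, (Omega `|` supp nu) z -> phi z = h z * psi z)
  (hV : forall z, ((Omega `|` supp nu) `\` vg_set V) z -> h z != 0) :
  let c (k : nat) (z w : Cn R n) : Cplx R := phi w ^+ k / phi z ^+ k * s z w in
  (forall k : nat,
     reproducing (minus_germ V) nu (holo_cont_k nu V k) (hardy_k nu V k) (c k)) /\
  ((forall z, (Omega `|` supp nu) z -> h z != 0) ->
   (exists r : R, forall w, supp nu w -> cmod (phi w) = r) ->
   forall k : nat,
     is_szego_kernel (minus_germ V) nu (holo_cont_k nu V k) (hardy_k nu V k)
       (c k)).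
Proof.
move=> c.
have rep k : reproducing (minus_germ V) nu (holo_cont_k nu V k) (hardy_k nu V k) (c k).
  exact: (kernel_reproducing hOmega hnu VT adm hs Aphi hpsi Ah phiE hV).
split; first exact: rep.
move=> h0 [r phir] k; split; first exact: rep.
by move=> z; exact: (kernel_conj_hardy hnu VT adm hs Aphi hpsi Ah phiE k h0 phir).
Qed.
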